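(* The following two problems each strongly $N$-reduce to the other: (i) for every $Y^{2}$ there is $X\subseteq\mathbb{N}$ with $X=J(Y)$, where $J(Y):=\{n\in\mathbb{N} : (\exists f\in\mathbb{N}^{\mathbb{N}})(Y(f,n)=0)\}$; (ii) every monotone (increasing) net in Cantor space $C=2^{\mathbb{N}}$, ordered lexicographically by $\leq_{\textsf{lex}}$, and indexed by Baire space, has a limit.
   Context: Work in the language of higher-order arithmetic: objects of type $0$ are natural numbers, of type $1$ elements of Baire space $\mathbb{N}^{\mathbb{N}}$, of type $2$ functionals $Y:\mathbb{N}^{\mathbb{N}}\to\mathbb{N}$; a functional of two arguments $Y(f,n)$ is understood via standard pairing as a type-2 object. Subsets of $\mathbb{N}$ and of $\mathbb{N}^{\mathbb{N}}$ are given by characteristic functions. A ''problem'' is a statement of the form $(\forall Y^{2})(\exists x^{1})A(Y,x)$ (parameters of higher type such as nets, sets, functions $[0,1]\to\mathbb{R}$ are coded as type-2 objects, and outputs such as reals, subsets of $\mathbb{N}$ or finite sequences of reals are coded as type-1 objects). For problems $P_A\equiv(\forall Y^{2})(\exists x^{1})A(Y,x)$ and $P_B\equiv(\forall Z^{2})(\exists y^{1})B(Z,y)$, say that $P_B$ $N$-reduces to $P_A$ if there are an index $e\in\mathbb{N}$ and terms $s^{2\to1}$, $t^{2\to2}$ of Gödel's system $T$ such that $(\forall Z^{2},x^{1})\big[A(t(Z),x)\to[\{e\}^{s(Z,x)}\downarrow\wedge B(Z,\{e\}^{s(Z,x)})]\big]$, where $\{e\}^{X}$ is the $e$-th Turing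 machine with oracle $X$ (computing an element of $\mathbb{N}^{\mathbb{N}}$, with $\downarrow$ meaning it is total). The reduction is strong if $s(Z,x)$ can be taken of the form $u(x)$ for a term $u$ of Gödel's $T$ not depending on $Z$. A directed set is a nonempty $D$ with a transitive, reflexive relation $\preceq$ such that any two elements have a common upper bound; a net in $X$ is a map $x:D\to X$, written $(x_d)_{d\in D}$; it converges to $y$ (its limit) if for every neighbourhood $U$ of $y$ there is $d_0\in D$ with $x_e\in U$ for all $e\succeq d_0$. A net is indexed by Baire space if $D\subseteq\mathbb{N}^{\mathbb{N}}$ (with $\preceq$ given as a functional). A net $f_d:D\to C$ is increasing if $a\preceq b$ implies $f_a\leq_{\textsf{lex}} f_b$. *)

(* Defs.v *)
From HB Require Import structures.
From mathcomp Require Import all_boot.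
From mathcomp Require Import boolp classical_sets topology cantor.

Set Implicit Arguments.
Unset Strict Implicit.
Unset Printing Implicit Defensive.

Local Open Scope classical_set_scope.

(** * Gödel's system T, interpreted in the full type structure over [nat] *)

Inductive ty : Set := Nat | Arr of ty & ty.

Fixpoint ty_sem (a : ty) : Set :=
  match a with
  | Nat => nat
  | Arr a b => ty_sem a -> ty_sem b
  end.

Definition ty1 : ty := Arr Nat Nat.
Definition ty2 : ty := Arr ty1 Nat.

Definition type1 : Set := nat -> nat.
Definition type2 : Set := type1 -> nat.

(* Typed de Bruijn indices. *)
Inductive var : seq ty -> ty -> Set :=
| VZ G a : var (a :: G) a
| VS G a b : var G a -> var (b :: G) a.

Inductive term : seq ty -> ty -> Set :=
| Var G a : var G a -> term G a
| App G a b : term G (Arr a b) -> term G a -> term G b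
| Lam G a b : term (a :: G) b -> term G (Arr a b)
| Zero G : term G Nat
| Succ G : term G (Arr Nat Nat)
| Rec G a : term G (Arr a (Arr (Arr Nat (Arr a a)) (Arr Nat a))).

Fixpoint env (G : seq ty) : Set :=
  if G is a :: G' then (ty_sem a * env G')%type else unit.

Fixpoint var_sem G a (v : var G a) : env G -> ty_sem a :=
  match v in var G a return env G -> ty_sem a with
  | VZ _ _ => fun r => r.1
  | VS _ _ _ v' => fun r => var_sem v' r.2
  end.

Fixpoint rec_sem (A : Set) (x : A) (g : nat -> A -> A) (n : nat) : A :=
  if n is m.+1 then g m (rec_sem x g m) else x.

Fixpoint term_sem G a (t : term G a) : env G -> ty_sem a :=
  match t in term G a return env G -> ty_sem a with
  | Var _ _ v => var_sem v
  | App _ _ _ f u => fun r => term_sem f r (term_sem u r)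
  | Lam _ _ _ f => fun r x => term_sem f (x, r)
  | Zero _ => fun _ => 0
  | Succ _ => fun _ n => n.+1
  | Rec _ a => fun _ => @rec_sem (ty_sem a)
  end.

Definition closed_term (a : ty) : Set := term [::] a.

Definition interp (a : ty) (t : closed_term a) : ty_sem a := term_sem t tt.

(** * Oracle Turing machines

  Deterministic machines with a work tape and an oracle tape, both two-way
  infinite.  Symbols and states are natural numbers, 0 being both the blank
  symbol and the initial state; a finite program mentions only finitely many
  of them. *)

Inductive move : Set := MLeft | MStay | MRight.

(* [Write a b m m'] writes [a] on the work tape and [b] on the oracle tape,
   then moves the two heads according to [m] and [m'] respectively. *)
Inductive action : Set :=
| Write of nat & nat & move & move
| Query.

Definition move_code (m : move) : option bool :=
  match m with MLeft => Some false | MStay => None | MRight => Some true end.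
Definition move_decode (o : option bool) : move :=
  match o with Some false => MLeft | None => MStay | Some true => MRight end.
Lemma move_codeK : cancel move_code move_decode. Proof. by case. Qed.
HB.instance Definition _ := Countable.copy move (can_type move_codeK).

Definition action_code (i : action) : option (nat * nat * move * move) :=
  if i is Write a b m m' then Some (a, b, m, m') else None.
Definition action_decode (o : option (nat * nat * move * move)) : action :=
  if o is Some (a, b, m, m') then Write a b m m' else Query.
Lemma action_codeK : cancel action_code action_decode. Proof. by case. Qed.
HB.instance Definition _ := Countable.copy action (can_type action_codeK).

(* An entry [((q, a, b), (i, q'))] applies in state [q] when [a] and [b] are
   the symbols scanned on the work and oracle tapes; it performs [i] and goes
   to state [q'].  The first applicable entry is the one executed, and the
   machine halts when there is none. *)
Definition machine : Type := seq ((nat * nat * nat) * (action * nat)).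

(* Contents to the left of the head (nearest cell first), scanned symbol,
   contents to the right; all other cells are blank. *)
Definition tape : Type := (seq nat * nat * seq nat)%type.

Definition unary (n : nat) : tape :=
  ([::], head 0 (nseq n 1), behead (nseq n 1)).

Definition scanned (t : tape) : nat := t.1.2.

Definition ones (t : tape) : nat :=
  let: (l, a, r) := t in count_mem 1 (l ++ a :: r).

Definition write_move (a : nat) (m : move) (t : tape) : tape :=
  let: (l, _, r) := t in
  match m with
  | MLeft => (behead l, head 0 l, a :: r)
  | MStay => (l, a, r)
  | MRight => (a :: l, head 0 r, behead r)
  end.

Definition config : Type := (nat * tape * tape)%type.

Fixpoint lookup (M : machine) (k : nat * nat * nat) : option (action * nat) :=
  if M is (k', r) :: M' then if k == k' then Some r else lookup M' k else None.

(* A query replaces the contents of the oracle tape, read as the number of 1s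
   on it, by the value of the oracle at that number, written in unary. *)
Definition step (X : type1) (M : machine) (c : config) : option config :=
  let: (q, w, o) := c in
  match lookup M (q, scanned w, scanned o) with
  | None => None
  | Some (Write a b m m', q') => Some (q', write_move a m w, write_move b m' o)
  | Some (Query, q') => Some (q', w, unary (X (ones o)))
  end.

Inductive reaches (X : type1) (M : machine) : config -> config -> Prop :=
| reaches_refl c : reaches X M c c
| reaches_step c c' c'' :
    step X M c = Some c' -> reaches X M c' c'' -> reaches X M c c''.

(* The input is given in unary on the work tape; the output is the number of
   1s on the work tape when the machine halts. *)
Definition halts_with (X : type1) (M : machine) (n m : nat) : Prop :=
  exists q w o,
    [/\ reaches X M (0, unary n, unary 0) (q, w, o),
        step X M (q, w, o) = None
      & ones w = m].

Definition nth_machine (e : nat) : machine := odflt [::] (unpickle e).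

(* [{e}^X] is total and equal to [y]. *)
Definition Turing_computes (e : nat) (X y : type1) : Prop :=
  forall n, halts_with X (nth_machine e) n (y n).

(** * Problems and N-reductions *)

(* The problem [forall Y, exists x, A Y x] is given by its matrix [A]. *)
Definition problem : Type := type2 -> type1 -> Prop.

Definition N_reduction (PB PA : problem)
    (e : nat) (s : type2 -> type1 -> type1) (t : type2 -> type2) : Prop :=
  forall (Z : type2) (x : type1),
    PA (t Z) x -> exists y, Turing_computes e (s Z x) y /\ PB Z y.

Definition N_reduces (PB PA : problem) : Prop :=
  exists (e : nat) (s : closed_term (Arr ty2 (Arr ty1 ty1)))
         (t : closed_term (Arr ty2 ty2)),
    N_reduction PB PA e (interp s) (interp t).

Definition strongly_N_reduces (PB PA : problem) : Prop :=
  exists (e : nat) (u : closed_term (Arr ty1 ty1))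
         (t : closed_term (Arr ty2 ty2)),
    N_reduction PB PA e (fun _ x => interp u x) (interp t).

(** * Pairing *)

(* [N * N^N] is identified with [N^N] by [fcons], and [N^N * N^N] by [fjoin]. *)
Definition fcons (n : nat) (f : type1) : type1 :=
  fun k => if k is k'.+1 then f k' else n.

Definition fjoin (f g : type1) : type1 :=
  fun k => if odd k then g k./2 else f k./2.

(** * The problem [exists X, X = J(Y)] *)

Definition is_char_of (x : type1) (A : set nat) : Prop :=
  forall n, (x n = 1 /\ A n) \/ (x n = 0 /\ ~ A n).

Definition J (Y : type2) : set nat :=
  [set n | exists f : type1, Y (fcons n f) = 0].

Definition J_problem : problem := fun Y x => is_char_of x (J Y).

(** * Convergence of increasing nets in Cantor space *)

Definition directed_set (I : Type) (D : set I) (le : I -> I -> Prop) : Prop :=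
  [/\ D !=set0,
      (forall a, D a -> le a a),
      (forall a b c, D a -> D b -> D c -> le a b -> le b c -> le a c)
    & (forall a b, D a -> D b -> exists c, [/\ D c, le a c & le b c])].

Definition net_converges (T : topologicalType) (I : Type) (D : set I)
    (le : I -> I -> Prop) (x : I -> T) (y : T) : Prop :=
  forall U : set T, nbhs y U ->
    exists d0, D d0 /\ forall d, D d -> le d0 d -> U (x d).

Definition le_lex (f g : cantor_space) : Prop :=
  f =1 g \/
  exists n, (forall i, i < n -> f i = g i) /\ f n = false /\ g n = true.

Definition increasing_net (I : Type) (D : set I) (le : I -> I -> Prop)
    (x : I -> cantor_space) : Prop :=
  forall a b, D a -> D b -> le a b -> le_lex (x a) (x b).

Definition binary (f : type1) : Prop := forall n, f n = 0 \/ f n = 1.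

Definition to_cantor (f : type1) : cantor_space := fun n => f n == 1.

(* A type-2 object [Z] codes three functionals, according to the first entry
   of the argument: the characteristic functions of [D] (0) and of the
   relation on [D] (1), and the map [(d, n) |-> x_d(n)] (2). *)
Definition net_dom (Z : type2) : set type1 := [set d | Z (fcons 0 d) = 1].

Definition net_le (Z : type2) (a b : type1) : Prop :=
  Z (fcons 1 (fjoin a b)) = 1.

Definition net_val (Z : type2) (d : type1) : type1 :=
  fun n => Z (fcons 2 (fcons n d)).

Definition codes_net (Z : type2) : Prop :=
  [/\ (forall d, Z (fcons 0 d) = 0 \/ Z (fcons 0 d) = 1),
      (forall a b, net_dom Z a -> net_dom Z b ->
         Z (fcons 1 (fjoin a b)) = 0 \/ Z (fcons 1 (fjoin a b)) = 1),
      (forall d, net_dom Z d -> binary (net_val Z d))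
    & directed_set (net_dom Z) (net_le Z)].

Definition monotone_net_problem : problem := fun Z x =>
  codes_net Z ->
  increasing_net (net_dom Z) (net_le Z) (fun d => to_cantor (net_val Z d)) ->
  binary x /\
  net_converges (net_dom Z) (net_le Z) (fun d => to_cantor (net_val Z d))
    (to_cantor x).

(* Main.v *)
(** An increasing net that computes the jump of [Y] must have an order that is
  decidable relative to [Y] in system T, so its indices cannot be compared as
  functions.  An index is instead a number [k] together with one candidate
  witness for every [n]; its value is the set of those [n < k] whose candidate
  is correct, and indices are compared by [k] and by these finite sets.  The
  limit of this net is the jump.

  Conversely, the limit of an increasing net is found digit by digit: once the
  prefix [s] is known, the next digit is 1 iff some value of the net extends
  [s] followed by 1, because by monotonicity the net can then never leave that
  neighbourhood of [s].  These queries are answered by one jump. *)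

From mathcomp Require Import all_boot zify.
From mathcomp Require Import boolp classical_sets topology cantor.
Require Import Defs.

Set Implicit Arguments.
Unset Strict Implicit.
Unset Printing Implicit Defensive.

Local Open Scope classical_set_scope.

Lemma binary_to_cantor (f : type1) n : binary f -> to_cantor f n = f n :> nat.
Proof. by rewrite /to_cantor => /(_ n)[] ->. Qed.

Lemma is_char_ofP (x : type1) (A : set nat) :
  is_char_of x A <-> binary x /\ forall n, to_cantor x n <-> A n.
Proof.
rewrite /to_cantor; split=> [xA|[x01 xA] n].
  by split=> n; case: (xA n) => -[-> An]; [right|left| |]; split.
case: (x01 n) (xA n) => -> [to_A from_A]; [right|left]; split=> //.
  by move=> /from_A.
exact: to_A.
Qed.

Definition net_point (Z : type2) (d : type1) : cantor_space :=
  to_cantor (net_val Z d).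

(** * Increasing nets in Cantor space *)

Lemma le_lex_next_bit (f g : cantor_space) n :
  (forall i, i < n -> f i = g i) -> le_lex f g -> f n -> g n.
Proof.
move=> eq_fg [->//|[m [eq_m [fm gm]]]] fn.
by case: (ltngtP n m) => [/eq_m <- //|/eq_fg|->//]; rewrite fm gm.
Qed.

Lemma le_lex_pointwise (f g : cantor_space) :
  (forall n, f n -> g n) -> le_lex f g.
Proof.
move=> le_fg; have [|/existsNP[k /eqP neq_k]] := pselect (f =1 g).
  by left.
have ex_neq : exists n, f n != g n by exists k.
right; case: (ex_minnP ex_neq) => n neq_n min_n.
exists n; split=> [i lt_in|].
  by apply/eqP; apply: contraTT lt_in => /min_n; rewrite -leqNgt.
by move: neq_n (le_fg n); case: (f n) (g n) => [] [] // _ ->.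
Qed.

Definition greedy_limit_of (I : Type) (D : set I) (x : I -> cantor_space)
    (y : cantor_space) : Prop :=
  forall n, y n <-> exists d, [/\ D d, forall i, i < n -> x d i = y i & x d n].

Section NetTails.
Variables (I : Type) (D : set I) (le : I -> I -> Prop).

Definition tails : set_system I :=
  filter_from D (fun d0 => [set d | D d /\ le d0 d]).

Lemma net_convergesE (T : topologicalType) (x : I -> T) (y : T) :
  net_converges D le x y <-> x @ tails --> y.
Proof.
split=> [cvx U /cvx[d0 [Dd0 Ud0]]|cvx U /cvx[d0 Dd0 Ud0]].
  by exists d0 => // d [Dd le_d0d]; exact: Ud0.
by exists d0; split=> // d Dd le_d0d; exact: Ud0.
Qed.

Hypothesis dirD : directed_set D le.

Lemma tails_proper_filter : ProperFilter tails.
Proof.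
have [[d Dd] le_refl le_trans le_ub] := dirD.
apply: filter_from_proper => [|d0 Dd0]; last first.
  by exists d0; split=> //; exact: le_refl.
apply: filter_from_filter => [|a b Da Db]; first by exists d.
have [c [Dc le_ac le_bc]] := le_ub a b Da Db.
by exists c => // e [De le_ce]; split; split=> //; exact: le_trans le_ce.
Qed.

Lemma near_tails_above d0 : D d0 -> \forall d \near tails, D d /\ le d0 d.
Proof. exact: in_filter_from. Qed.

Lemma near_tails_domain : \forall d \near tails, D d.
Proof. by have [[d0 Dd0] _ _ _] := dirD; exists d0 => // d []. Qed.

Lemma cantor_net_convergesP (x : I -> cantor_space) (y : cantor_space) :
  net_converges D le x y <-> forall n, \forall d \near tails, x d n = y n.
Proof.
have FF := tails_proper_filter.
rewrite net_convergesE (@pointwise_cvgP nat bool).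
have digit_cvgE n : (fun d => x d n) @ tails --> y n <->
    \forall d \near tails, x d n = y n by exact: discrete_cvg.
by split=> cvx n; apply/digit_cvgE; exact: cvx.
Qed.

Lemma pointwise_increasing_net_limit
    (x : I -> cantor_space) (y : cantor_space) :
  (forall a b n, D a -> D b -> le a b -> x a n -> x b n) ->
  net_converges D le x y -> forall n, y n <-> exists2 d, D d & x d n.
Proof.
move=> incx /cantor_net_convergesP cvx n; have FF := tails_proper_filter.
split=> [yn|[d0 Dd0 xd0n]].
  have [d [xdn Dd]] := filter_ex (filterI (cvx n) near_tails_domain).
  by exists d; rewrite ?xdn.
have [d [<- [Dd le_d0d]]] := filter_ex (filterI (cvx n) (near_tails_above Dd0)).
exact: incx xd0n.
Qed.

Lemma increasing_net_converges (x : I -> cantor_space) (y : cantor_space) :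
  increasing_net D le x -> greedy_limit_of D x y -> net_converges D le x y.
Proof.
move=> incx yP; have FF := tails_proper_filter.
suff near_prefix n : \forall d \near tails, forall i, i < n -> x d i = y i.
  apply/cantor_net_convergesP => n.
  by apply: filterS (near_prefix n.+1) => d; exact.
elim: n => [|n near_prefix]; first exact: filterE.
suff near_digit : \forall d \near tails, x d n = y n.
  apply: filterS2 near_prefix near_digit => d eq_prefix eq_digit i.
  by rewrite ltnS leq_eqVlt => /predU1P[->//|]; exact: eq_prefix.
case yn: (y n).
  have [d0 [Dd0 eq_d0 xd0n]] := (yP n).1 yn.
  apply: filterS2 near_prefix (near_tails_above Dd0) => d eq_d [Dd le_d0d].
  apply: le_lex_next_bit (incx _ _ Dd0 Dd le_d0d) xd0n => i lt_in.
  by rewrite eq_d0 ?eq_d.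
apply: filterS2 near_prefix near_tails_domain => d eq_d Dd.
by apply: contraFF yn => xdn; apply/yP; exists d.
Qed.

End NetTails.

(** * A machine that copies its oracle *)

(* State 0 moves the input to the oracle tape, state 1 moves the answer back. *)
Definition copy_oracle : machine :=
  [:: ((0, 1, 0), (Write 0 1 MRight MRight, 0));
      ((0, 0, 0), (Query, 1));
      ((1, 0, 1), (Write 1 0 MRight MRight, 1))].

Lemma reaches_trans X M c1 c2 c3 :
  reaches X M c1 c2 -> reaches X M c2 c3 -> reaches X M c1 c3.
Proof.
by elim=> // c c' c'' cc' _ reaches_tail /reaches_tail; exact: reaches_step.
Qed.

Lemma copy_oracle_read_input X i k :
  reaches X copy_oracle
    (0, (nseq i 0, head 0 (nseq k 1), behead (nseq k 1)),
        (nseq i 1, 0, [::]))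
    (0, (nseq (i + k) 0, 0, [::]), (nseq (i + k) 1, 0, [::])).
Proof.
elim: k i => [|k IHk] i; first by rewrite addn0; exact: reaches_refl.
by eapply reaches_step; [reflexivity|]; rewrite addnS -addSn; exact: (IHk i.+1).
Qed.

Lemma copy_oracle_write_answer X l l' i k :
  reaches X copy_oracle
    (1, (nseq i 1 ++ l, 0, [::]),
        (nseq i 0 ++ l', head 0 (nseq k 1), behead (nseq k 1)))
    (1, (nseq (i + k) 1 ++ l, 0, [::]), (nseq (i + k) 0 ++ l', 0, [::])).
Proof.
elim: k i => [|k IHk] i; first by rewrite addn0; exact: reaches_refl.
by eapply reaches_step; [reflexivity|]; rewrite addnS -addSn; exact: (IHk i.+1).
Qed.

Lemma copy_oracle_computes X : Turing_computes (pickle copy_oracle) X X.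
Proof.
move=> n; rewrite /nth_machine pickleK /=.
exists 1, (nseq (X n) 1 ++ nseq n 0, 0, [::]), (nseq (X n) 0, 0, [::]); split.
- apply: reaches_trans (copy_oracle_read_input X 0 n) _.
  eapply reaches_step; [reflexivity|]; rewrite add0n.
  have -> : ones (nseq n 1, 0, [::]) = n.
    by rewrite /ones count_cat count_nseq /=; lia.
  have := copy_oracle_write_answer X (nseq n 0) [::] 0 (X n).
  by rewrite !cats0 add0n; exact.
- by [].
- by rewrite /ones !count_cat !count_nseq /=; lia.
Qed.

Lemma strongly_N_reduces_by_terms (PB PA : problem)
    (u : closed_term (Arr ty1 ty1)) (t : closed_term (Arr ty2 ty2)) :
  (forall Z x, PA (interp t Z) x -> PB Z (interp u x)) ->
  strongly_N_reduces PB PA.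
Proof.
move=> red; exists (pickle copy_oracle), u, t => Z x /red PBx.
by exists (interp u x); split; first exact: copy_oracle_computes.
Qed.

(** * Programming in system T *)

Local Notation "f <@> u" := (App f u) (at level 40, left associativity).
Local Notation v0 := (Var (VZ _ _)).
Local Notation v1 := (Var (VS _ (VZ _ _))).
Local Notation v2 := (Var (VS _ (VS _ (VZ _ _)))).
Local Notation v3 := (Var (VS _ (VS _ (VS _ (VZ _ _))))).
Local Notation rec x g n := (Rec _ _ <@> x <@> g <@> n).
Local Notation zero := (Zero _).
Local Notation succ n := (Succ _ <@> n).

Definition pred_term {G} : term G (Arr Nat Nat) :=
  Lam (rec zero (Lam (Lam v1)) v0).

Definition if_term {G} : term G (Arr Nat (Arr Nat (Arr Nat Nat))) :=
  Lam (Lam (Lam (rec v1 (Lam (Lam v2)) v2))).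

Definition add_term {G} : term G (Arr Nat (Arr Nat Nat)) :=
  Lam (Lam (rec v1 (Lam (Lam (succ v0))) v0)).

Definition fcons_term {G} : term G (Arr Nat (Arr ty1 ty1)) :=
  Lam (Lam (Lam (rec v2 (Lam (Lam (v3 <@> v1))) v0))).

Lemma pred_termE G (r : env G) n : term_sem pred_term r n = n.-1.
Proof. by case: n. Qed.

Lemma if_termE G (r : env G) n a b :
  term_sem if_term r n a b = if n == 0 then a else b.
Proof. by case: n. Qed.

Lemma add_termE G (r : env G) m n : term_sem add_term r m n = m + n.
Proof. by elim: n => /= [|n ->]; rewrite ?addn0 ?addnS. Qed.

Lemma fcons_termE G (r : env G) n f : term_sem fcons_term r n f = fcons n f.
Proof. by apply/funext => -[|k]. Qed.

Definition drop2_term {G} : term G (Arr ty1 ty1) :=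
  Lam (Lam (v1 <@> succ (succ v0))).

(* Opacity lets simplification stop at terms whose semantics is known. *)
#[local] Opaque pred_term if_term add_term fcons_term.

Definition sub_term {G} : term G (Arr Nat (Arr Nat Nat)) :=
  Lam (Lam (rec v1 (Lam (Lam (pred_term <@> v0))) v0)).

Definition double_term {G} : term G (Arr Nat Nat) :=
  Lam (add_term <@> v0 <@> v0).

Definition all_term {G} : term G (Arr ty1 (Arr Nat Nat)) :=
  Lam (Lam (rec (succ zero)
    (Lam (Lam (if_term <@> (v3 <@> v1) <@> v0 <@> zero))) v0)).

Lemma sub_termE G (r : env G) m n : term_sem sub_term r m n = m - n.
Proof.
elim: n => /= [|n ->]; first by rewrite subn0.
by rewrite pred_termE subnS.
Qed.

Lemma double_termE G (r : env G) n : term_sem double_term r n = n.*2.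
Proof. by rewrite /= add_termE addnn. Qed.

Lemma all_termE G (r : env G) p n :
  term_sem all_term r p n = all (fun i => p i == 0) (iota 0 n).
Proof.
elim: n => // n IHn; rewrite -[n.+1 in RHS]addn1 iotaD all_cat /= andbT.
by rewrite if_termE [rec_sem _ _ _]IHn; case: eqP; rewrite ?andbT ?andbF.
Qed.

#[local] Opaque sub_term double_term all_term.

Definition eq_term {G} : term G (Arr Nat (Arr Nat Nat)) :=
  Lam (Lam (add_term <@> (sub_term <@> v1 <@> v0)
                     <@> (sub_term <@> v0 <@> v1))).

Lemma eq_termE G (r : env G) m n : (term_sem eq_term r m n == 0) = (m == n).
Proof. by rewrite /= add_termE !sub_termE addn_eq0 !subn_eq0 -eqn_leq. Qed.

#[local] Opaque eq_term.

(** * From the jump to increasing nets *)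

(* [d] codes the number [d 0] and the candidate witnesses [slot d n] for all
   [n], the indices [2 ^ n * (2 m + 1)] being positive and pairwise distinct. *)
Definition slot (d : type1) (n : nat) : type1 :=
  fun m => d (2 ^ n * m.*2.+1).

Definition unslot (k : nat) (w : nat -> type1) : type1 :=
  fun j => if j == 0 then k else w (logn 2 j) (j %/ 2 ^ logn 2 j)./2.

Lemma slot_unslot k w n : slot (unslot k w) n = w n.
Proof.
apply/funext => m; rewrite /slot /unslot muln_eq0 expn_eq0 /=.
rewrite lognM ?expn_gt0 // pfactorK // (@lognE 2 m.*2.+1) dvdn2 /=.
by rewrite odd_double /= addn0 mulKn ?expn_gt0 //= uphalf_double.
Qed.

Definition slot_term {G} : term G (Arr ty1 (Arr Nat ty1)) :=
  Lam (Lam (Lam (v2 <@> rec (succ (double_term <@> v0))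
    (Lam (Lam (double_term <@> v0))) v1))).

Lemma slot_termE G (r : env G) d n : term_sem slot_term r d n = slot d n.
Proof.
apply/funext => m; rewrite /slot /=; congr (d _); elim: n => /= [|n ->].
  by rewrite double_termE mul1n.
by rewrite double_termE expnS -mulnA mul2n.
Qed.

#[local] Opaque slot_term.

Section StageNet.
Variable Y : type2.

Definition stage (d : type1) (n : nat) : bool :=
  (n < d 0) && (Y (fcons n (slot d n)) == 0).

Definition stage_le (a b : type1) : bool :=
  (a 0 <= b 0) && all (fun n => stage a n ==> stage b n) (iota 0 (a 0)).

Lemma stage_leP a b : reflect
  (a 0 <= b 0 /\ forall n, stage a n -> stage b n) (stage_le a b).
Proof.
apply: (iffP andP) => -[le_ab sub_ab]; split=> //; last first.
  by apply/allP => n _; apply/implyP/sub_ab.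
move=> n stage_an; have /andP[lt_na _] := stage_an.
by move/allP/(_ n): sub_ab; rewrite mem_iota stage_an; exact.
Qed.

(* The upper bound keeps, for each [n], a witness that is correct for [a] or,
   failing that, for [b]. *)
Lemma stage_le_ub a b : exists c, stage_le a c /\ stage_le b c.
Proof.
pose c := unslot (maxn (a 0) (b 0))
  (fun n => if stage a n then slot a n else slot b n).
have slot_c n : slot c n = if stage a n then slot a n else slot b n.
  exact: slot_unslot.
exists c; split; apply/stage_leP; split=> [|n stage_n].
- exact: leq_maxl.
- move: (stage_n); rewrite /stage slot_c stage_n => /andP[lt_n ->].
  by rewrite andbT (leq_trans lt_n) // leq_maxl.
- exact: leq_maxr.
- have /andP[lt_n Y_n] := stage_n.
  rewrite /stage slot_c (leq_trans lt_n) ?leq_maxr //=.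
  by case: ifP => // /andP[].
Qed.

Lemma stage_le_directed : directed_set setT stage_le.
Proof.
split=> [|a _|a b c _ _ _|a b _ _]; first by exists id.
- by apply/stage_leP.
- move=> /stage_leP[le_ab sub_ab] /stage_leP[le_bc sub_bc].
  apply/stage_leP; split=> [|n /sub_ab /sub_bc//]; exact: leq_trans le_bc.
- by have [c []] := stage_le_ub a b; exists c.
Qed.

Lemma J_stageP n : J Y n <-> exists d, stage d n.
Proof.
split=> [[f Yf]|[d /andP[_ /eqP Yd]]]; last by exists (slot d n).
by exists (unslot n.+1 (fun=> f)); rewrite /stage slot_unslot Yf /= leqnn.
Qed.

End StageNet.

Definition stage_term {G} : term G (Arr ty2 (Arr ty1 ty1)) :=
  Lam (Lam (Lam (if_term <@> (sub_term <@> succ v0 <@> (v1 <@> zero))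
    <@> (if_term <@> (v2 <@> (fcons_term <@> v0 <@> (slot_term <@> v1 <@> v0)))
           <@> succ zero <@> zero)
    <@> zero))).

Lemma stage_termE G (r : env G) Y d n :
  term_sem stage_term r Y d n = stage Y d n.
Proof.
rewrite /= !if_termE sub_termE fcons_termE slot_termE subn_eq0 /stage.
by case: ltnP => //= _; case: eqP.
Qed.

#[local] Opaque stage_term.

Definition stage_le_term {G} : term G (Arr ty2 (Arr ty1 (Arr ty1 Nat))) :=
  Lam (Lam (Lam (if_term <@> (sub_term <@> (v1 <@> zero) <@> (v0 <@> zero))
    <@> (all_term <@> Lam (sub_term <@> (stage_term <@> v3 <@> v2 <@> v0)
                                    <@> (stage_term <@> v3 <@> v1 <@> v0))
                  <@> (v1 <@> zero))
    <@> zero))).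

Lemma stage_le_termE G (r : env G) Y a b :
  term_sem stage_le_term r Y a b = stage_le Y a b.
Proof.
rewrite /= if_termE sub_termE subn_eq0 all_termE /stage_le.
case: leqP => //= _; congr nat_of_bool; apply: eq_all => n.
by rewrite sub_termE !stage_termE; case: stage; case: stage.
Qed.

#[local] Opaque stage_le_term.

Definition stage_net_term : closed_term (Arr ty2 ty2) :=
  Lam (Lam (if_term <@> (v0 <@> zero) <@> succ zero <@>
    (if_term <@> (pred_term <@> (v0 <@> zero))
       <@> (stage_le_term <@> v1
              <@> Lam (v1 <@> succ (double_term <@> v0))
              <@> Lam (v1 <@> succ (succ (double_term <@> v0))))
       <@> (stage_term <@> v1 <@> (drop2_term <@> v0)
              <@> (v0 <@> succ zero))))).

Section StageNetTerm.
Variable Y : type2.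
Local Notation stage_net := (interp stage_net_term Y).

Lemma stage_net_dom_char d : stage_net (fcons 0 d) = 1.
Proof. by rewrite /interp /= if_termE. Qed.

Lemma stage_net_le_char a b : stage_net (fcons 1 (fjoin a b)) = stage_le Y a b.
Proof.
rewrite /interp /= !if_termE pred_termE /= stage_le_termE.
congr (nat_of_bool (stage_le Y _ _)); apply/funext => k.
  by rewrite double_termE /fjoin odd_double doubleK.
by rewrite double_termE /fjoin /= odd_double uphalf_double.
Qed.

Lemma stage_net_val d : net_val stage_net d = stage Y d.
Proof.
apply/funext => n.
by rewrite /net_val /interp /= !if_termE pred_termE stage_termE.
Qed.

Lemma stage_net_dom : net_dom stage_net = setT.
Proof. by apply/seteqP; split=> // d _; exact: stage_net_dom_char. Qed.

Lemma stage_net_le : net_le stage_net = stage_le Y.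
Proof.
apply/funext => a; apply/funext => b; apply/propext.
by rewrite /net_le stage_net_le_char; case: stage_le.
Qed.

Lemma stage_net_point : net_point stage_net = stage Y.
Proof.
apply/funext => d; apply/funext => n.
by rewrite /net_point /to_cantor stage_net_val; case: stage.
Qed.

Lemma stage_net_codes : codes_net stage_net.
Proof.
split=> [d|a b _ _|d _ n|].
- by right; exact: stage_net_dom_char.
- by rewrite stage_net_le_char; case: stage_le; [right|left].
- by rewrite stage_net_val; case: stage; [right|left].
- by rewrite stage_net_dom stage_net_le; exact: stage_le_directed.
Qed.

Lemma stage_net_increasing :
  increasing_net (net_dom stage_net) (net_le stage_net) (net_point stage_net).
Proof.
move=> a b _ _; rewrite stage_net_le stage_net_point => /stage_leP[_].
exact: le_lex_pointwise.
Qed.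

End StageNetTerm.

Lemma J_reduces_to_monotone_net :
  strongly_N_reduces J_problem monotone_net_problem.
Proof.
apply: (strongly_N_reduces_by_terms (u := Lam v0) (t := stage_net_term)) => Y x.
move=> /(_ (stage_net_codes Y) (stage_net_increasing (Y := Y))) [x01].
rewrite -/(net_point _) stage_net_dom stage_net_le stage_net_point => cvx.
apply/is_char_ofP; split=> // n.
apply: iff_trans (iff_sym (J_stageP Y n)).
have dirY := stage_le_directed Y.
apply: iff_trans (pointwise_increasing_net_limit dirY _ cvx n) _.
  by move=> a b k _ _ /stage_leP[_]; exact.
by split=> [[d _]|[d]]; exists d.
Qed.

(** * From increasing nets to the jump *)

(* The number with binary digits 1, [f 0], ..., [f (n - 1)]: the leading 1 makes
   the code determine [n]. *)
Fixpoint prefix_code (f : nat -> bool) (n : nat) : nat :=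
  if n is m.+1 then f m + (prefix_code f m).*2 else 1.

Lemma prefix_code_gt0 f n : 0 < prefix_code f n.
Proof. by elim: n => //= n; lia. Qed.

Lemma prefix_code_eqP f g m n : prefix_code f m = prefix_code g n <->
  m = n /\ forall i, i < n -> f i = g i.
Proof.
split=> [|[-> {m}]]; last first.
  elim: n => //= n IHn eq_fg; rewrite eq_fg // IHn // => i lt_in.
  by apply: eq_fg; exact: ltnW.
elim: m n => [|m IHm] [|n] //=.
- by have := prefix_code_gt0 g n; lia.
- by have := prefix_code_gt0 f m; lia.
- move=> eq_code; have eq_bit : f m = g n.
    by have := congr1 odd eq_code; rewrite !oddD !odd_double !addbF !oddb.
  have [|eq_mn eq_fg] := IHm n; first by move: eq_code; rewrite eq_bit; lia.
  split=> [|i]; first by rewrite eq_mn.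
  by rewrite ltnS leq_eqVlt => /predU1P[->|/eq_fg//]; rewrite -eq_bit eq_mn.
Qed.

Lemma prefix_code_extend1P f g k n :
  prefix_code f k = (prefix_code g n).*2.+1 <->
  [/\ k = n.+1, forall i, i < n -> f i = g i & f n].
Proof.
split=> [|[-> eq_fg fn]]; last first.
  by rewrite /= fn; congr (_.*2.+1); apply/prefix_code_eqP.
case: k => [|k] /= eq_code; first by have := prefix_code_gt0 g n; lia.
have fk : f k.
  by have := congr1 odd eq_code; rewrite oddD /= !odd_double addbF oddb.
have [|eq_kn eq_fg] := (prefix_code_eqP f g k n).1; last by subst k.
by move: eq_code; rewrite fk; lia.
Qed.

Definition prefix_code_term {G} : term G (Arr ty1 (Arr Nat Nat)) :=
  Lam (Lam (rec (succ zero)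
    (Lam (Lam (add_term <@> (v3 <@> v1) <@> (double_term <@> v0)))) v0)).

Lemma prefix_code_termE G (r : env G) (f : type1) n : binary f ->
  term_sem prefix_code_term r f n = prefix_code (to_cantor f) n.
Proof.
move=> f01; elim: n => //= n ->.
by rewrite add_termE double_termE binary_to_cantor.
Qed.

Definition net_val_term {G} : term G (Arr ty2 (Arr ty1 ty1)) :=
  Lam (Lam (Lam (v2 <@> (fcons_term <@> succ (succ zero)
                           <@> (fcons_term <@> v0 <@> v1))))).

Lemma net_val_termE G (r : env G) Z d :
  term_sem net_val_term r Z d = net_val Z d.
Proof. by apply/funext => n; rewrite /= !fcons_termE. Qed.

#[local] Opaque prefix_code_term net_val_term.

Definition prefix_search_term : closed_term (Arr ty2 ty2) :=
  Lam (Lam (add_term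
    <@> (eq_term <@> (v1 <@> (fcons_term <@> zero <@> (drop2_term <@> v0)))
                 <@> succ zero)
    <@> (eq_term
           <@> (prefix_code_term
                  <@> (net_val_term <@> v1 <@> (drop2_term <@> v0))
                  <@> (v0 <@> succ zero))
           <@> (v0 <@> zero)))).

Lemma fcons_head_tail (f : type1) : fcons (f 0) (f \o S) = f.
Proof. by apply/funext => -[]. Qed.

Lemma J_prefix_searchP Z m : codes_net Z ->
  J (interp prefix_search_term Z) m <->
  exists k d, net_dom Z d /\ prefix_code (net_point Z d) k = m.
Proof.
move=> [_ _ Z01 _].
have searchP k d : interp prefix_search_term Z (fcons m (fcons k d)) = 0 <->
    net_dom Z d /\ prefix_code (net_point Z d) k = m.
  rewrite /interp /= add_termE fcons_termE net_val_termE.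
  apply: iff_trans (rwP eqP) _; rewrite addn_eq0 !eq_termE.
  split=> [/andP[/eqP Df]|[Df codeE]].
    by rewrite prefix_code_termE => [/eqP|]; [split|exact: Z01].
  by rewrite prefix_code_termE ?codeE ?eqxx ?andbT; [exact/eqP|exact: Z01].
split=> [[f]|[k [d /searchP search_kd]]]; last by exists (fcons k d).
by rewrite -(fcons_head_tail f) => /searchP code_m; exists (f 0), (f \o S).
Qed.

(* [x] decides which numbers are codes of prefixes of values of the net, and the
   next digit is 1 iff the prefix found so far followed by 1 is one of them. *)
Fixpoint greedy_code (x : type1) (n : nat) : nat :=
  if n is m.+1 then
    let code := greedy_code x m in x code.*2.+1 + code.*2
  else 1.

Definition greedy_limit (x : type1) : type1 :=
  fun n => x (greedy_code x n).*2.+1.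

Lemma binary_greedy_limit x : binary x -> binary (greedy_limit x).
Proof. by move=> x01 n; exact: x01. Qed.

Lemma greedy_codeE x n : binary x ->
  greedy_code x n = prefix_code (to_cantor (greedy_limit x)) n.
Proof.
move=> x01; elim: n => //= n <-.
by rewrite (binary_to_cantor n (binary_greedy_limit x01)).
Qed.

Definition greedy_limit_term {G} : term G (Arr ty1 ty1) :=
  Lam (Lam (v1 <@> succ (double_term <@> rec (succ zero)
    (Lam (Lam (add_term <@> (v3 <@> succ (double_term <@> v0))
                        <@> (double_term <@> v0)))) v0))).

Lemma greedy_limit_termE G (r : env G) x :
  term_sem greedy_limit_term r x = greedy_limit x.
Proof.
apply/funext => n; rewrite /= double_termE /greedy_limit; congr (x _.*2.+1).
by elim: n => //= n ->; rewrite add_termE !double_termE.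
Qed.

Lemma greedy_limit_correct Z x : codes_net Z ->
  J_problem (interp prefix_search_term Z) x ->
  greedy_limit_of (net_dom Z) (net_point Z) (to_cantor (greedy_limit x)).
Proof.
move=> codesZ /is_char_ofP[x01 xJ] n.
have -> : to_cantor (greedy_limit x) n =
    to_cantor x (prefix_code (to_cantor (greedy_limit x)) n).*2.+1.
  by rewrite -greedy_codeE.
apply: iff_trans (xJ _) _; apply: iff_trans (J_prefix_searchP _ codesZ) _.
split=> [[k [d [Dd /prefix_code_extend1P[_ eq_d dn]]]]|[d [Dd eq_d dn]]].
  by exists d.
by exists n.+1, d; split=> //; apply/prefix_code_extend1P.
Qed.

Lemma monotone_net_reduces_to_J :
  strongly_N_reduces monotone_net_problem J_problem.
Proof.
apply: (strongly_N_reduces_by_terms (u := greedy_limit_term)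
  (t := prefix_search_term)) => Z x xJ codesZ incZ.
have [x01 _] := (is_char_ofP _ _).1 xJ; have [_ _ _ dirZ] := codesZ.
rewrite /interp greedy_limit_termE; split; first exact: binary_greedy_limit.
by apply: increasing_net_converges => //; exact: greedy_limit_correct.
Qed.

Theorem theorem1 :
  strongly_N_reduces J_problem monotone_net_problem /\
  strongly_N_reduces monotone_net_problem J_problem.
Proof.
split; [exact: J_reduces_to_monotone_net|exact: monotone_net_reduces_to_J].
Qed.
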